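(* Let $G=(V,E)$ be a finite tree with integer node capacities $b_i\ge 0$ ($i\in V$), and let $a_{ij}:=\min\{b_i,b_j\}$ for $(i,j)\in E$. Let $S$ be the set of $(x,y)\in\mathbb{R}^E\times\{0,1\}^E$ satisfying $$\sum_{j\in V:\,(i,j)\in E}x_{ij}\le b_i\ (i\in V),\qquad 0\le x_{ij}\le a_{ij}y_{ij}\ ((i,j)\in E).$$ For $i\in V$, let $\delta(i)$ be the set of edges incident to $i$, and let $R_i$ (the single-node relaxation at $i$ of the unary-expansion formulation) be the set of vectors $(x_{ij},y_{ij},(z_{ijl})_{0\le l\le a_{ij}})_{(i,j)\in\delta(i)}$ with $$\sum_{(i,j)\in\delta(i)}x_{ij}\le b_i$$ and, for every $(i,j)\in\delta(i)$, $$0\le x_{ij}\le a_{ij}y_{ij},\quad \sum_{l=0}^{a_{ij}}l\,z_{ijl}=x_{ij},\quad \sum_{l=1}^{a_{ij}}z_{ijl}\le y_{ij},\quad \sum_{l=0}^{a_{ij}}z_{ijl}=1,\quad y_{ij}\in\{0,1\},\quad z_{ijl}\in\{0,1\}\ (0\le l\le a_{ij}).$$ Then convexifying each single-node relaxation separately in the $(x,y,z)$-space describes $\mathrm{conv}(S)$: the set of all $(x,y)\in\mathbb{R}^E\times\mathbb{R}^E$ for which there exists $z=(z_{ijl})_{(i,j)\in E,\,0\le l\le a_{ij}}$ such that, for every $i\in V$, the restriction of $(x,y,z)$ to the edges in $\delta(i)$ belongs to $\mathrm{conv}(R_i)$, is equal to $\mathrm{conv}(S)$.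
   Context: Edges are undirected: $(i,j)=(j,i)$, and $x_{ij}=x_{ji}$, $y_{ij}=y_{ji}$, $z_{ijl}=z_{jil}$, $a_{ij}=a_{ji}$ are indexed by edges; $l$ is an integer index. $\mathrm{conv}(X)$ denotes the convex hull of a set $X$ of real vectors. The unary-expansion formulation of the fixed-charge transportation problem on $G$ is the formulation in variables $(x,y,z)$ imposing all capacity constraints and all the edge constraints displayed in the definition of the sets $R_i$; $z_{ijl}=1$ is intended to mean $x_{ij}=l$. *)

(* Defs.v *)
From HB Require Import structures.
From mathcomp Require Import all_boot all_order all_algebra.
From mathcomp Require Import classical_sets reals convex.

Set Implicit Arguments.
Unset Strict Implicit.
Unset Printing Implicit Defensive.

Import Order.TTheory GRing.Theory Num.Theory.

Local Open Scope ring_scope.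

Definition conv_hull (R : realType) (M : lmodType R) (A : set M) : set M :=
  smallest (@convex_set R M) A.

(* A duplicate-free closed walk of length at most 2 in a simple graph is empty
   or runs back and forth along one edge, so the last condition forbids exactly
   the cycles of the graph. *)
Definition is_tree (V : finType) (e : rel V) : Prop :=
  [/\ symmetric e, irreflexive e, (0 < #|V|)%N,
      forall i j : V, connect e i j
    & forall c : seq V, ucycle e c -> (size c <= 2)%N].

Definition edge (V : finType) (e : rel V) : finType :=
  {f : {set V} | [exists i, exists j, e i j && (f == [set i; j])]}.

Definition delta (V : finType) (e : rel V) (i : V) : finType :=
  {f : edge e | i \in val f}.

(* a_ij = min {b_i, b_j}; the initial value of the iterated minimum is
   irrelevant, see capE. *)
Definition cap (V : finType) (e : rel V) (b : V -> nat) (f : edge e) : nat :=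
  \big[minn / \max_(i : V) b i]_(i in val f) b i.

Lemma capE (V : finType) (e : rel V) (b : V -> nat) (f : edge e) (i j : V) :
  val f = [set i; j] -> cap b f = minn (b i) (b j).
Proof.
move=> fE; rewrite /cap fE -minEnat; apply/eqP; rewrite eq_le le_min.
rewrite !bigmin_le_cond ?inE ?eqxx ?orbT//=.
apply: le_bigmin => [|k /set2P[]->]; rewrite ?ge_min ?lexx ?orbT//.
by rewrite leEnat leq_bigmax.
Qed.

Local Open Scope classical_set_scope.

Section Formulation.
Variables (R : realType) (V : finType) (e : rel V) (b : V -> nat).

Definition xy_space : lmodType R :=
  ({ffun edge e -> R^o} * {ffun edge e -> R^o})%type.

Definition fctp : set xy_space :=
  [set p : {ffun edge e -> R} * {ffun edge e -> R} | let: (x, y) := p in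
    [/\ forall i : V, \sum_(f : edge e | i \in val f) x f <= (b i)%:R,
        forall f : edge e, 0 <= x f <= (cap b f)%:R * y f
      & forall f : edge e, y f = 0 \/ y f = 1]].

(* The unary variables z_{ijl} are indexed by an edge together with a value
   l in {0, ..., a_ij}. *)
Definition zindex : finType := {f : edge e & 'I_(cap b f).+1}.

Definition zindex_at (i : V) : finType :=
  {f : delta e i & 'I_(cap b (val f)).+1}.

Definition zi (i : V) (f : delta e i) (l : 'I_(cap b (val f)).+1) :
    zindex_at i :=
  Tagged (fun g : delta e i => 'I_(cap b (val g)).+1) l.

Definition node_space (i : V) : lmodType R :=
  ({ffun delta e i -> R^o} * {ffun delta e i -> R^o}
   * {ffun zindex_at i -> R^o})%type.

Definition single_node_relaxation (i : V) : set (node_space i) :=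
  [set p : {ffun delta e i -> R} * {ffun delta e i -> R}
           * {ffun zindex_at i -> R} | let: (x, y, z) := p in
    \sum_(f : delta e i) x f <= (b i)%:R /\
    forall f : delta e i,
      [/\ 0 <= x f <= (cap b (val f))%:R * y f,
          \sum_(l < (cap b (val f)).+1) (l : nat)%:R * z (zi l) = x f,
          \sum_(l < (cap b (val f)).+1 | (0 < l)%N) z (zi l) <= y f,
          \sum_(l < (cap b (val f)).+1) z (zi l) = 1
        & (y f = 0 \/ y f = 1) /\
          forall l : 'I_(cap b (val f)).+1, z (zi l) = 0 \/ z (zi l) = 1]].

Definition restrict (i : V) (x y : {ffun edge e -> R})
    (z : {ffun zindex -> R}) : node_space i :=
  ([ffun f => x (val f)], [ffun f => y (val f)],
   [ffun k : zindex_at i =>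
      z (Tagged (fun f : edge e => 'I_(cap b f).+1) (tagged k))]).

End Formulation.

Arguments fctp R {V} e b.
Arguments single_node_relaxation R {V} e b i.

(* Main.v *)
Require Import Defs.
From mathcomp Require Import all_boot all_order all_algebra.
From mathcomp Require Import classical_sets reals convex.
From mathcomp Require Import boolp interval_inference ring lra.

(** A point of a single-node relaxation is integral, and on each edge it is a
state [(l, y)]: the value [l] of x together with the bit y, where z is the
indicator vector of [l].  A point of the convex hull at a node is therefore the
mean of a finite random configuration of states on the incident edges
([node_law_of_hull]).  Two nodes see the same numbers (y_f, z_f) on a common edge
f, and these numbers determine the law of the state of f: a state with [l > 0]
has y = 1, so P(l, 1) = z_l, P(0, 1) = y - sum_(l > 0) z_l and P(0, 0) = 1 - y.
Hence the laws at the two ends of an edge have the same marginal on that edge.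
This is the only reason for the variables z: the pair (x, y) alone does not
determine the marginal.

Local laws with matching marginals can be glued along a tree.  A connected set U
of nodes and an outside node i adjacent to it share a single edge (two edges
would close a cycle, [unique_attachment]), so a law for U and a law for i can be
coupled to agree on that edge ([coupling]) and merged into a law for U + i
([has_lawU1]).  When U is the whole tree, the law lives on configurations that
are feasible at all nodes, hence on points of the transportation problem, and
its mean is (x, y) ([projection_in_hull]).

For the converse, the projected set is convex, so it suffices to lift each
(x, y) satisfying the transportation constraints, with x possibly fractional.
Each x_f is rounded to its floor or to the next integer with mean x_f, which
fixes z without reference to a node.  At each node the rounding amounts to a
point of a polytope of the form (box [0, 1]^I cut by sum u <= K) with integer K,
and such polytopes are integral ([box_sum_le_integral]), so that the lifted point
lies in the convex hull at the node ([rounding_in_hull]). *)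

Set Implicit Arguments.
Unset Strict Implicit.
Unset Printing Implicit Defensive.

Import Order.TTheory GRing.Theory Num.Theory.

Local Open Scope ring_scope.
Local Open Scope classical_set_scope.

(** * Convex hulls *)

Section Convexity.
Variable R : realType.

Lemma convex_setP (M : lmodType R) (A : set M) :
  @convex_set R M A <->
  forall t x y, 0 <= t <= 1 -> A x -> A y -> A (t *: x + (1 - t) *: y).
Proof.
split=> [cA t x y t01 Ax Ay | cA x y t /set_mem Ax /set_mem Ay].
  have := @cA x y (Itv01 (proj1 (andP t01)) (proj2 (andP t01))).
  by rewrite !in_setE; apply.
by rewrite in_setE; apply: cA => //; apply/andP; split.
Qed.

Lemma conv_hull_min (M : lmodType R) (A C : set M) :
  (forall t x y, 0 <= t <= 1 -> C x -> C y -> C (t *: x + (1 - t) *: y)) ->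
  A `<=` C -> conv_hull A `<=` C.
Proof. by move=> /convex_setP cC AC; apply: smallest_sub. Qed.

Lemma conv_hull_sub (M : lmodType R) (A : set M) x : A x -> conv_hull A x.
Proof. exact: sub_gen_smallest. Qed.

Lemma conv_hull_convex (M : lmodType R) (A : set M) t x y :
  0 <= t <= 1 -> conv_hull A x -> conv_hull A y ->
  conv_hull A (t *: x + (1 - t) *: y).
Proof.
move=> t01 hx hy C [cC AC]; move/convex_setP: (cC); apply=> //.
- exact: hx.
- exact: hy.
Qed.

Lemma conv_hull_affine (M N : lmodType R) (A : set M) (B : set N)
    (F : M -> N) :
  (forall t x y, F (t *: x + (1 - t) *: y) = t *: F x + (1 - t) *: F y) ->
  (forall x, A x -> conv_hull B (F x)) ->
  forall x, conv_hull A x -> conv_hull B (F x).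
Proof.
move=> affF FA; apply: conv_hull_min => [t x y t01 hx hy | x]; last exact: FA.
by rewrite /= affF; apply: conv_hull_convex.
Qed.

Let ratio_in01 (a b : R) : 0 <= a -> 0 <= b -> 0 < a + b ->
  0 <= a / (a + b) <= 1.
Proof. by move=> *; rewrite divr_ge0 ?ler_pdivrMr //; lra. Qed.

Lemma conv_hull_between (M : lmodType R) (A : set M) (u d : M) (s t : R) :
  0 < s -> 0 < t -> conv_hull A (u + s *: d) -> conv_hull A (u - t *: d) ->
  conv_hull A u.
Proof.
move=> s0 t0 hs ht; have st0 : t + s != 0 by lra.
have -> : u = (t / (t + s)) *: (u + s *: d) +
              (1 - t / (t + s)) *: (u - t *: d).
  rewrite !scalerDr addrACA -scalerDl addrC scalerN !scalerA -scalerBl.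
  rewrite (_ : _ - _ = 0); last by field.
  by rewrite scale0r add0r (_ : _ + _ = 1) ?scale1r //; ring.
apply: conv_hull_convex => //.
by apply: ratio_in01; lra.
Qed.

(** A finite mean, where only the points of nonzero weight are constrained.
The statement is normalised by the partial weight to make the induction on the
list of indices go through. *)
Lemma conv_hull_sum (M : lmodType R) (A : set M) (I : finType) (w : I -> R)
    (p : I -> M) :
  (forall k, 0 <= w k) -> \sum_k w k = 1 ->
  (forall k, w k != 0 -> A (p k)) -> conv_hull A (\sum_k w k *: p k).
Proof.
move=> w0 w1 Ap.
suff H (s : seq I) : 0 < \sum_(k <- s) w k ->
    conv_hull A ((\sum_(k <- s) w k)^-1 *: \sum_(k <- s) w k *: p k).
  by have := H (index_enum I); rewrite w1 invr1 scale1r; apply; exact: ltr01.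
elim: s => [|k s IHs]; first by rewrite big_nil ltxx.
rewrite !big_cons; set W := \sum_(j <- s) w j; set P := \sum_(j <- s) _.
have W0 : 0 <= W by apply: sumr_ge0 => j _.
have [wk0|wkN0] := eqVneq (w k) 0.
  by rewrite wk0 scale0r !add0r; exact: IHs.
have wkP : 0 < w k by rewrite lt_def wkN0 w0.
have Ak : conv_hull A (p k) by exact: conv_hull_sub (Ap _ wkN0).
have [WE|WN0] := eqVneq W 0.
  have PE : P = 0.
    apply: big1_seq => j /andP[_ js]; move/eqP: WE.
    rewrite psumr_eq0 => [/allP /(_ j js) /= /eqP ->|? _]; last exact: w0.
    by rewrite scale0r.
  by rewrite WE PE !addr0 scalerA mulVf // scale1r.
have WP : 0 < W by rewrite lt_def WN0.
move=> kW; have -> : (w k + W)^-1 *: (w k *: p k + P) =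
    (w k / (w k + W)) *: p k + (1 - w k / (w k + W)) *: (W^-1 *: P).
  rewrite scalerDr !scalerA; congr (_ *: _ + _ *: _); field; lra.
apply: conv_hull_convex; [|exact: Ak|exact: IHs].
by apply: ratio_in01; lra.
Qed.

End Convexity.

(** * Couplings *)

(** Two finite laws with the same image law m on T are coupled on the fibre
product over T by making them conditionally independent given the common
value. *)
Lemma coupling (R : realType) (I J : finType) (T : eqType)
    (w : I -> R) (v : J -> R) (s : I -> T) (t : J -> T) :
  (forall k, 0 <= w k) -> (forall l, 0 <= v l) ->
  (forall a, \sum_k w k * (s k == a)%:R = \sum_l v l * (t l == a)%:R) ->
  exists r : I -> J -> R,
    [/\ forall k l, 0 <= r k l,
        forall k l, r k l != 0 -> [/\ w k != 0, v l != 0 & s k = t l],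
        forall k, \sum_l r k l = w k
      & forall l, \sum_k r k l = v l].
Proof.
move=> w0 v0 wv; pose m a := \sum_k w k * (s k == a)%:R.
have m0 a : 0 <= m a by apply: sumr_ge0 => k _; rewrite mulr_ge0.
have mw k : m (s k) = 0 -> w k = 0.
  move/eqP; rewrite psumr_eq0 => [/allP /(_ k)|l _]; last by rewrite mulr_ge0.
  by rewrite mem_index_enum eqxx mulr1 => /(_ isT) /eqP.
have mv l : m (t l) = 0 -> v l = 0.
  rewrite /m wv => /eqP.
  rewrite psumr_eq0 => [/allP /(_ l)|k _]; last by rewrite mulr_ge0.
  by rewrite mem_index_enum eqxx mulr1 => /(_ isT) /eqP.
(* The division by m (s k) = 0 is harmless: w k and v l then vanish. *)
exists (fun k l => (s k == t l)%:R * (w k * v l / m (s k))); split=> /=.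
- by move=> k l; apply: mulr_ge0 => //; apply: divr_ge0 => //; exact: mulr_ge0.
- move=> k l; case: (s k =P t l) => [->|_]; last by rewrite mul0r eqxx.
  by rewrite mul1r !mulf_eq0 !negb_or -andbA => /and3P[].
- move=> k; transitivity (w k / m (s k) * \sum_l v l * (t l == s k)%:R).
    rewrite mulr_sumr; apply: eq_bigr => l _.
    by rewrite [t l == _]eq_sym; ring.
  by rewrite -wv -/(m _); have [/mw->|?] := eqVneq (m (s k)) 0; rewrite ?mul0r // divfK.
- move=> l; transitivity (v l / m (t l) * \sum_k w k * (s k == t l)%:R).
    rewrite mulr_sumr; apply: eq_bigr => k _.
    by case: eqP => [->|_] /=; ring.
  by rewrite -/(m _); have [/mv->|?] := eqVneq (m (t l)) 0; rewrite ?mul0r // divfK.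
Qed.

(** * Integrality of a box cut by a cardinality constraint *)

Section BoxIntegrality.
Variables (R : realType) (I : finType).

Definition is_fractional (u : {ffun I -> R}) : pred I :=
  [pred f | (u f != 0) && (u f != 1)].

Lemma fractional_decrease (u v : {ffun I -> R}) (p : I) :
  is_fractional u p -> ~~ is_fractional v p ->
  (forall f, is_fractional v f -> is_fractional u f) ->
  (#|is_fractional v| < #|is_fractional u|)%N.
Proof.
move=> up vp vu; apply: proper_card; apply/properP; split.
  by apply/fintype.subsetP => f; exact: vu.
by exists p.
Qed.

(** Induction on the number of fractional coordinates.  Two fractional
coordinates p and q can be traded against each other (direction e_p - e_q) in
both senses until one of them becomes integral, with the sum unchanged.  A single
fractional coordinate p can be moved alone to 0 or to 1: the remaining sum is an
integer that is less than K, so rounding up keeps the sum at most K.  Recording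
the support D ensures that null coordinates are never raised. *)
Lemma box_sum_le_integral (K : nat) (D : {set I}) (u : {ffun I -> R^o}) :
  (forall f, 0 <= u f <= 1) -> (forall f, f \notin D -> u f = 0) ->
  \sum_f u f <= K%:R ->
  conv_hull [set [ffun f => (f \in A)%:R : R^o] | A in
              [set A : {set I} | (#|A| <= K)%N /\ (A \subset D)]] u.
Proof.
have [n] := ubnP #|is_fractional u|.
elim: n u => [//|n IHn] u; rewrite ltnS => un u01 uD uK.
have sum_split (P : {pred I}) : (forall f, f \notin P -> ~~ is_fractional u f) ->
    \sum_f u f = #|[set f | (u f == 1) && (f \notin P)]%SET|%:R + \sum_(f in P) u f.
  move=> uP; rewrite (bigID (mem P)) /= addrC -sum1_card natr_sum; congr (_ + _).
  rewrite big_mkcond [RHS]big_mkcond; apply: eq_bigr => f _ /=.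
  rewrite inE andbC; have := uP f; case: (f \in P) => //= /(_ isT).
  rewrite /is_fractional /= negb_and !negbK.
  by case/orP=> /eqP->; rewrite ?eqxx // eq_sym oner_eq0.
(* A move along d that makes p integral and no integral coordinate fractional
   lands, by induction, in the hull. *)
have step (d : {ffun I -> R^o}) p s : is_fractional u p ->
    (u + s *: d) p = 0 \/ (u + s *: d) p = 1 ->
    (forall f, ~~ is_fractional u f -> d f = 0) ->
    (forall f, 0 <= (u + s *: d) f <= 1) -> \sum_f (u + s *: d) f <= K%:R ->
    conv_hull [set [ffun f => (f \in A)%:R : R^o] | A in
              [set A : {set I} | (#|A| <= K)%N /\ (A \subset D)]] (u + s *: d).
  move=> up vp d0 v01 vK; apply: IHn => //.
    apply: leq_trans un; apply: (fractional_decrease up).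
      by rewrite /is_fractional /=; case: vp => ->; rewrite eqxx // andbF.
    move=> f; apply: contraLR => uf; move: (uf).
    by rewrite /is_fractional /= !ffunE d0 // scaler0 addr0.
  move=> f fD; rewrite !ffunE d0 ?scaler0 ?addr0 ?uD //.
  by rewrite /is_fractional /= uD // eqxx.
have frac01 f : is_fractional u f -> 0 < u f < 1.
  rewrite /is_fractional /= => /andP[? ?].
  by have := u01 f; rewrite !lt_neqAle eq_sym; lra.
case: (pickP (is_fractional u)) => [p up | u0]; last first.
  apply: conv_hull_sub => /=; exists [set f | u f == 1]%SET.
    split; last first.
      apply/fintype.subsetP => f; rewrite inE; apply: contraLR => /uD ->.
      by rewrite eq_sym oner_eq0.
    move: uK; rewrite (sum_split pred0) => [|f _]; last by rewrite u0.
    rewrite big_pred0 // addr0 ler_nat; congr (_ <= _)%N.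
    by apply: eq_card => f; rewrite !inE andbT.
  apply/ffunP => f; rewrite ffunE inE; move/negbT: (u0 f).
  rewrite /is_fractional /= negb_and !negbK.
  by case/orP=> /eqP ->; rewrite ?eqxx // eq_sym oner_eq0.
have up01 := frac01 p up.
case: (pickP [pred q | is_fractional u q & q != p]) => [q /= /andP[uq qp] | u1].
  pose d : {ffun I -> R^o} := [ffun f => (f == p)%:R - (f == q)%:R].
  have dp : d p = 1 by rewrite ffunE eqxx eq_sym (negbTE qp) subr0.
  have dq : d q = -1 by rewrite ffunE eqxx (negbTE qp) sub0r.
  have d0 f : f != p -> f != q -> d f = 0.
    by move=> /negbTE fp /negbTE fq; rewrite ffunE fp fq subrr.
  have uq01 := frac01 q uq.
  have d0' f : ~~ is_fractional u f -> d f = 0.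
    by move=> uf; apply: d0; apply: contra uf => /eqP ->.
  have sumd s : \sum_f (u + s *: d) f = \sum_f u f.
    under eq_bigr => f _ do rewrite !ffunE.
    rewrite big_split /= -scaler_sumr sumrB.
    have one (a : I) : \sum_f (f == a)%:R = 1 :> R.
      by rewrite (bigD1 a) //= eqxx big1 ?addr0 // => f /negbTE ->.
    by rewrite !one subrr scaler0 addr0.
  have box s : - u p <= s <= 1 - u p -> - (1 - u q) <= s <= u q ->
      forall f, 0 <= (u + s *: d) f <= 1.
    move=> sp sq f; rewrite [(u + _) f]ffunE [(s *: d) f]ffunE.
    have [->|fp] := eqVneq f p; first by rewrite dp /GRing.scale /=; lra.
    have [->|fq] := eqVneq f q; first by rewrite dq /GRing.scale /=; lra.
    by rewrite d0 // scaler0 addr0.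
  have val s : ((u + s *: d) p = u p + s) * ((u + s *: d) q = u q - s).
    by rewrite ![(u + _) _]ffunE ![(s *: d) _]ffunE dp dq /GRing.scale /= mulr1 mulrN1.
  apply: (@conv_hull_between _ _ _ _ d
    (Num.min (1 - u p) (u q)) (Num.min (u p) (1 - u q))).
  - by rewrite lt_min; lra.
  - by rewrite lt_min; lra.
  - case: (leP (1 - u p) (u q)) => pq.
      by apply: (step d p) => //; rewrite ?sumd // ?val;
         [right; ring | apply: box; lra].
    by apply: (step d q) => //; rewrite ?sumd // ?val;
         [left; ring | apply: box; lra].
  - rewrite -scaleNr; case: (leP (u p) (1 - u q)) => pq.
      by apply: (step d p) => //; rewrite ?sumd // ?val;
         [left; ring | apply: box; lra].
    by apply: (step d q) => //; rewrite ?sumd // ?val;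
         [right; ring | apply: box; lra].
have u1' f : f != p -> ~~ is_fractional u f.
  by move=> fp; have := u1 f; rewrite /= fp andbT => ->.
have sumu := sum_split (pred1 p) u1'; rewrite big_pred1_eq in sumu.
set N := #|_| in sumu.
have NK : (N < K)%N.
  by rewrite -(ltr_nat R); apply: lt_le_trans uK; rewrite sumu; lra.
pose d : {ffun I -> R^o} := [ffun f => (f == p)%:R].
have val s f : (u + s *: d) f = u f + s * (f == p)%:R.
  by rewrite !ffunE.
have sumd s : \sum_f (u + s *: d) f = N%:R + (u p + s).
  under eq_bigr => f _ do rewrite val.
  rewrite big_split /= sumu -addrA; congr (_ + (_ + _)).
  by rewrite (bigD1 p) //= eqxx mulr1 big1 ?addr0 // => f /negbTE ->; rewrite mulr0.
have d0 f : ~~ is_fractional u f -> d f = 0.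
  by rewrite ffunE; case: eqP => // ->; rewrite up.
have NK' : N%:R + 1 <= K%:R :> R by rewrite natr1 ler_nat.
have box s : - u p <= s <= 1 - u p -> forall f, 0 <= (u + s *: d) f <= 1.
  move=> sp f; rewrite val; have [->|_] := eqVneq f p; first by rewrite mulr1; lra.
  by rewrite mulr0 addr0.
apply: (@conv_hull_between _ _ _ _ d (1 - u p) (u p)); [lra|lra| |].
  apply: (step d p) => //; rewrite ?val ?eqxx ?mulr1; [right; ring|apply: box; lra|].
  by rewrite sumd; lra.
rewrite -scaleNr.
apply: (step d p) => //; rewrite ?val ?eqxx ?mulr1; [left; ring|apply: box; lra|].
by rewrite sumd; lra.
Qed.

End BoxIntegrality.

(** * Growing a connected set of nodes in a tree *)

Section Graph.
Variables (V : finType) (e : rel V).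

Lemma edgeP (f : edge e) : exists i j, e i j /\ val f = [set i; j]%SET.
Proof. by have /existsP[i /existsP[j /andP[eij /eqP fE]]] := valP f; exists i, j. Qed.

Lemma edge_ex i j : e i j -> exists f : edge e, val f = [set i; j]%SET.
Proof.
move=> eij; suff P : [exists k, exists l, e k l && ([set i; j]%SET == [set k; l]%SET)].
  by exists (Sub [set i; j]%SET P); rewrite SubK.
by apply/existsP; exists i; apply/existsP; exists j; rewrite eij eqxx.
Qed.

Lemma edge_two_nodes (f : edge e) i j : symmetric e -> i != j ->
  i \in val f -> j \in val f -> e i j /\ val f = [set i; j]%SET.
Proof.
move=> sym_e; have [k [l [ekl ->]]] := edgeP f.
rewrite !inE => ij /orP[]/eqP ik /orP[]/eqP jl; subst; rewrite ?eqxx // in ij *.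
by rewrite sym_e finset.setUC.
Qed.

Lemma boundary_edge (U : {set V}) : (forall i j, connect e i j) ->
  U != finset.set0 -> U != finset.setT ->
  exists i j, [/\ i \notin U, j \in U & e j i].
Proof.
move=> conn /set0Pn[j jU] UT; apply: contrapT => noedge.
case/negP: UT; apply/eqP/finset.setP => i; rewrite inE.
have /connectP[p ep ->] := conn j i.
elim: p j jU ep => [|k p IHp] j jU //= /andP[ejk ep]; apply: (IHp k) => //.
by apply: contrapT => /negP kU; apply: noedge; exists k, j.
Qed.

Definition connected_inside (U : {set V}) : Prop := forall j k,
  j \in U -> k \in U ->
  exists p, [/\ path e j p, last j p = k & {subset p <= U}].

Lemma connected_insideU1 (U : {set V}) i j : symmetric e ->
  connected_inside U -> j \in U -> e j i -> connected_inside (i |: U)%SET.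
Proof.
move=> sym_e cU jU eji k l; rewrite !inE.
have widen (p : seq V) : {subset p <= U} -> {subset p <= (i |: U)%SET}.
  by move=> pU x /pU; rewrite !inE orbC => ->.
case/orP=> [/eqP->|kU] /orP[/eqP->|lU].
- by exists [::]; split.
- have [p [ep pl pU]] := cU _ _ jU lU; exists (j :: p); split=> //=.
    by rewrite sym_e eji.
  by apply: widen => x; rewrite inE => /orP[/eqP->|/pU].
- have [p [ep pl pU]] := cU _ _ kU jU; exists (rcons p i); split.
  + by rewrite rcons_path ep pl.
  + by rewrite last_rcons.
  + by move=> x; rewrite mem_rcons !inE => /orP[->//|/pU ->]; rewrite orbT.
- by have [p [ep pl /widen pU]] := cU _ _ kU lU; exists p.
Qed.

(** Two distinct neighbours j and k of i in U would be joined by a simple path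
inside U, and closing it through i gives a cycle of length at least 3. *)
Lemma unique_attachment (U : {set V}) i j k : is_tree e ->
  connected_inside U -> i \notin U -> j \in U -> k \in U ->
  e i j -> e i k -> k = j.
Proof.
case=> sym_e _ _ _ acyclic cU iU jU kU eij eik.
have [p [ep pk pU]] := cU _ _ jU kU.
case/shortenP: ep pk => q eq uq qp qk.
have : (size (i :: j :: q) <= 2)%N.
  apply: acyclic; apply/andP; split.
    by rewrite /cycle rcons_path /= eij eq /= qk sym_e.
  rewrite [uniq _]/= inE negb_or -andbA; apply/and3P; split; last exact: uq.
    by apply: contraNneq iU => ->.
  by apply: contra iU => /qp /pU.
by case: q {eq uq qp} qk => [/= -> //|].
Qed.

End Graph.

(** * Gluing laws of configurations along a tree *)

Section Gluing.
Variables (R : realType) (V : finType) (e : rel V) (b : V -> nat).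

(** The state of an edge is the pair of the integer x_f and the bit y_f. *)
Definition config := edge e -> nat * bool.

Definition feasible_at (i : V) (c : config) : Prop :=
  (\sum_(f : edge e | i \in val f) (c f).1 <= b i)%N /\
  forall f : edge e, i \in val f -> ((c f).1 <= cap b f * (c f).2)%N.

(** A finite random configuration, feasible at the nodes of U, whose states on
the edges touching U have the laws given by L.  A marginal law is represented by
its expectation functional [L f], so that marginal probabilities (g an
indicator) and means (g a coordinate) are read off in the same way. *)
Definition has_law (U : {set V}) (L : edge e -> (nat * bool -> R) -> R) : Prop :=
  exists (I : finType) (w : I -> R) (c : I -> config),
    [/\ forall k, 0 <= w k, \sum_k w k = 1,
        forall k i, w k != 0 -> i \in U -> feasible_at i (c k)
      & forall i (f : edge e), i \in U -> i \in val f ->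
        forall g, \sum_k w k * g (c k f) = L f g].

(** The only edge at i that touches U is f0 = {i, j}.  The two laws give the
state of f0 the same marginal, so they can be coupled to agree on f0; the merged
configuration follows the law at i on the edges at i and the law of U
elsewhere. *)
Lemma has_lawU1 (U : {set V}) i j (L : edge e -> (nat * bool -> R) -> R) :
  symmetric e -> i \notin U -> j \in U -> e i j ->
  (forall k, k \in U -> e i k -> k = j) ->
  has_law U L -> has_law [set i]%SET L -> has_law (i |: U)%SET L.
Proof.
move=> sym_e iU jU eij attach [I [w [c [w0 w1 cF cL]]]] [J [v [d [v0 v1 dF dL]]]].
have [f0 f0E] := edge_ex eij.
have shared k (f : edge e) : k \in U -> i \in val f -> k \in val f -> f = f0.
  move=> kU fi fk; have ik : i != k by apply: contraNneq iU => ->.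
  have [/(attach k kU) kj fE] := edge_two_nodes sym_e ik fi fk.
  by apply: val_inj; rewrite f0E fE kj.
have f0j : j \in val f0 by rewrite f0E !inE eqxx orbT.
have f0i : i \in val f0 by rewrite f0E !inE eqxx.
have [|r [r0 rP rw rv]] := @coupling R I J (nat * bool)%type w v
    (fun k => c k f0) (fun l => d l f0) w0 v0.
  move=> a; rewrite (cL j f0 jU f0j (fun s => (s == a)%:R)).
  by rewrite (dL i f0 _ f0i (fun s => (s == a)%:R)) ?inE.
pose m (q : I * J) : config := fun f => if i \in val f then d q.2 f else c q.1 f.
have mi q (f : edge e) : i \in val f -> m q f = d q.2 f by rewrite /m => ->.
have mU q (f : edge e) k : r q.1 q.2 != 0 -> k \in U -> k \in val f -> m q f = c q.1 f.
  move=> /rP[_ _ cd] kU fk; rewrite /m; case: ifP => // fi.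
  by rewrite (shared k f).
have feas_ext k c1 c2 : (forall f : edge e, k \in val f -> c1 f = c2 f) ->
    feasible_at k c1 -> feasible_at k c2.
  move=> c12 [cs cc]; split=> [|f fk]; last by rewrite -c12 ?cc.
  by apply: leq_trans cs; rewrite leq_eqVlt; apply/orP; left; apply/eqP;
     apply: eq_bigr => f fk; rewrite c12.
exists (I * J)%type, (fun q => r q.1 q.2), m; split=> [q|||] //.
- rewrite -(pair_bigA _ r) /= -w1.
  by apply: eq_bigr => k _; rewrite rw.
- move=> q k rq; have [wq vq _] := rP _ _ rq; rewrite !inE => /orP[/eqP->|kU].
    apply: (feas_ext i (d q.2)) => [f fi|]; first by rewrite mi.
    by apply: dF => //; rewrite inE.
  apply: (feas_ext k (c q.1)) => [f fk|]; last exact: cF.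
  by rewrite (mU q f k).
- move=> k f; rewrite !inE => kiU fk g.
  have [fi|fiN] := boolP (i \in val f).
    rewrite -(dL i f) ?inE // (eq_bigr (fun q => r q.1 q.2 * g (d q.2 f))).
      rewrite -(pair_bigA _ (fun k l => r k l * g (d l f))) exchange_big /=.
      by apply: eq_bigr => l _; rewrite -mulr_suml rv.
    by move=> [q1 q2] _; rewrite mi.
  have kU : k \in U.
    by case/orP: kiU => // /eqP ki; rewrite ki (negbTE fiN) in fk.
  rewrite -(cL k f kU fk) (eq_bigr (fun q => r q.1 q.2 * g (c q.1 f))).
    rewrite -(pair_bigA _ (fun k l => r k l * g (c k f))) /=.
    by apply: eq_bigr => l _; rewrite -mulr_suml rw.
  by move=> [q1 q2] _; rewrite /m (negbTE fiN).
Qed.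

Lemma has_law_tree L : is_tree e ->
  (forall i, has_law [set i]%SET L) -> has_law finset.setT L.
Proof.
move=> tree_e lawi; have [sym_e _ V0 conn _] := tree_e.
suff H n (U : {set V}) : (#|~: U|%SET <= n)%N -> U != finset.set0 ->
    connected_inside e U -> has_law U L -> has_law finset.setT L.
  have /card_gt0P[i _] := V0.
  apply: (H #|~: [set i]|%SET [set i]%SET) => //.
    by apply/set0Pn; exists i; rewrite inE.
  move=> j k; rewrite !inE => /eqP-> /eqP->; exists [::]; split=> //.
elim: n U => [|n IHn] U Un U0 cU lawU.
all: have [<- //|UT] := eqVneq U finset.setT.
all: have [i [j [iU jU eji]]] := boundary_edge conn U0 UT.
  by move: Un; rewrite leqn0 cards_eq0 => /eqP/finset.setP/(_ i); rewrite !inE iU.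
have eij : e i j by rewrite sym_e.
apply: (IHn (i |: U)%SET).
- rewrite -ltnS; apply: leq_trans Un; apply: proper_card.
  apply/properP; split; first by rewrite finset.setCS finset.subsetUr.
  by exists i; rewrite !inE // eqxx.
- by apply/set0Pn; exists i; rewrite !inE eqxx.
- exact: connected_insideU1 jU eji.
- apply: (has_lawU1 (j := j)) => // k kU eik.
  exact: (unique_attachment tree_e cU iU).
Qed.

End Gluing.

(** * From the convex hull at a node to a law of configurations *)

Section FixedChargeTransportation.
Variables (R : realType) (V : finType) (e : rel V) (b : V -> nat).

Lemma sum_delta (i : V) (S : nmodType) (F : edge e -> S) :
  \sum_(f : delta e i) F (val f) = \sum_(f : edge e | i \in val f) F f.
Proof.
rewrite [RHS](@reindex_omap _ _ _ (edge e) (delta e i) val insub) =>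
  [|f fi]; last by rewrite insubT.
by apply: eq_bigl => f; rewrite (valP f) valK eqxx.
Qed.

Lemma sum_indicator (a n : nat) (F : nat -> R) : (n <= a)%N ->
  \sum_(l < a.+1) F l * (l == n :> nat)%:R = F n.
Proof.
move=> na; rewrite (bigD1 (Ordinal (na : n < a.+1)%N)) //= eqxx mulr1.
rewrite big1 ?addr0 // => l; rewrite -val_eqE /= => /negbTE ->.
by rewrite mulr0.
Qed.

Lemma cap_bound (c : config e) i (f : edge e) :
  feasible_at b i c -> i \in val f -> ((c f).1 <= cap b f)%N.
Proof.
move=> [_ cc] /cc cf; apply: leq_trans cf _.
by case: (c f).2; rewrite ?muln1 ?muln0.
Qed.

Definition node_point (i : V) (c : config e) : node_space R e b i :=
  ([ffun f => (c (val f)).1%:R], [ffun f => (c (val f)).2%:R],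
   [ffun k : zindex_at e b i => (tagged k == (c (val (tag k))).1 :> nat)%:R]).

Lemma node_point_in (i : V) (c : config e) :
  feasible_at b i c -> single_node_relaxation R e b i (node_point i c).
Proof.
move=> [cs cc]; split.
  under eq_bigr => f _ do rewrite ffunE.
  by rewrite (sum_delta i (fun f => (c f).1%:R)) -natr_sum ler_nat.
move=> f; have cf := cc _ (valP f).
have c1 := cap_bound (conj cs cc) (valP f).
split.
- by rewrite !ffunE ler0n /= -natrM ler_nat.
- under eq_bigr => l _ do rewrite ffunE /=.
  by rewrite (@sum_indicator _ _ (fun l => l%:R)) // ffunE.
- under eq_bigr => l _ do rewrite ffunE /=.
  rewrite big_mkcond /=.
  under eq_bigr => l _ do rewrite -[X in if _ then X else _]mul1r -mulrb -mulrnAl.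
  rewrite (@sum_indicator _ _ (fun l => 1 *+ (0 < l)%N)) // ffunE ler_nat.
  case: (c (val f)).2 cf => [_|]; first exact: leq_b1.
  by rewrite muln0 leqn0 => /eqP ->.
- under eq_bigr => l _ do rewrite ffunE /= -[(_ == _)%:R]mul1r.
  by rewrite (@sum_indicator _ _ (fun=> 1)).
- split; first by rewrite ffunE; case: (c _).2; [right|left].
  by move=> l; rewrite ffunE; case: (_ == _); [right|left].
Qed.

Lemma unit_vector (a : nat) (z : 'I_a.+1 -> R) :
  (forall l, z l = 0 \/ z l = 1) -> \sum_l z l = 1 ->
  exists n, (n <= a)%N /\ forall l, z l = (l == n :> nat)%:R.
Proof.
move=> z01 z1; have [l zl|z0] := pickP (fun l => z l == 1); last first.
  move: z1; rewrite big1 => [/eqP|l _]; first by rewrite eq_sym oner_eq0.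
  by case: (z01 l) => // zl; have := z0 l; rewrite zl eqxx.
exists l; split=> [|k]; first by rewrite -ltnS.
have [/val_inj->|kl] := eqVneq (k : nat) l; first exact/eqP.
move: z1; rewrite (bigD1 l) //= (eqP zl) -[RHS]addr0 => /addrI/eqP.
rewrite psumr_eq0 => [/allP/(_ k)|j _]; last by case: (z01 j) => ->.
by rewrite mem_index_enum -val_eqE kl => /(_ isT)/eqP.
Qed.

(** The vectors z of a single-node relaxation are unit vectors, so its points are
exactly those read off from configurations. *)
Lemma node_point_onto (i : V) p : single_node_relaxation R e b i p ->
  exists2 c, feasible_at b i c & p = node_point i c.
Proof.
case: p => [[x y] z] [xb xyz].
have state f : exists s : nat * bool, [/\ x f = s.1%:R, y f = s.2%:R,
    (s.1 <= cap b (val f) * s.2)%N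
    & forall l : 'I_(cap b (val f)).+1, z (zi l) = (l == s.1 :> nat)%:R].
  have [/andP[_ xay] zx _ z1 [y01 z01]] := xyz f.
  have [n [na zn]] := unit_vector z01 z1.
  have xn : x f = n%:R.
    rewrite -zx; under eq_bigr => l _ do rewrite zn.
    exact: (@sum_indicator _ _ (fun l => l%:R)).
  exists (n, y f == 1); have yE : y f = (y f == 1)%:R.
    by case: y01 => ->; rewrite ?eqxx // eq_sym oner_eq0.
  by split=> //=; rewrite -(ler_nat R) natrM -xn -yE.
have [s sP] := boolp.choice state.
pose c : config e := fun f => if insub f is Some f' then s f' else (0%N, false).
have cE (f : delta e i) : c (val f) = s f by rewrite /c valK.
exists c.
  split.
    rewrite -(ler_nat R) natr_sum -sum_delta; apply: le_trans xb.
    rewrite le_eqVlt; apply/orP; left; apply/eqP; apply: eq_bigr => f _.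
    by rewrite cE; have [->] := sP f.
  by move=> f fi; have [_ _ + _] := sP (Sub f fi); rewrite -cE SubK.
congr (_, _, _); apply/ffunP.
- by move=> f; rewrite ffunE cE; have [] := sP f.
- by move=> f; rewrite ffunE cE; have [] := sP f.
- by move=> [f l]; rewrite ffunE /= cE; have [_ _ _] := sP f; apply.
Qed.

(** The expectation of [g (l, y)] when P(y = 1) = y, the value [l] has law z, and
[l > 0] forces y = 1.  The term [l = 0] of the sum vanishes. *)
Definition state_mean (a : nat) (y : R) (z : 'I_a.+1 -> R)
    (g : nat * bool -> R) : R :=
  (1 - y) * g (0%N, false) + y * g (0%N, true)
  + \sum_l z l * (g (l : nat, true) - g (0%N, true)).

Lemma state_mean_affine a t y y' (z z' : 'I_a.+1 -> R) g :
  state_mean (t * y + (1 - t) * y') (fun l => t * z l + (1 - t) * z' l) g =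
  t * state_mean y z g + (1 - t) * state_mean y' z' g.
Proof.
rewrite /state_mean; under eq_bigr => l _ do rewrite mulrDl -!mulrA.
by rewrite big_split /= -!mulr_sumr; ring.
Qed.

Lemma state_mean_point a (s : nat * bool) g : (s.1 <= a * s.2)%N ->
  @state_mean a s.2%:R (fun l => (l == s.1 :> nat)%:R) g = g s.
Proof.
case: s => n y /= ny; rewrite /state_mean.
under eq_bigr => l _ do rewrite mulrC.
rewrite (@sum_indicator _ _ (fun l => g (l, true) - g (0%N, true))).
  by case: y ny => /= [_|]; [ring | rewrite muln0 leqn0 => /eqP ->; ring].
by apply: leq_trans ny _; case: y; rewrite ?muln1 ?muln0.
Qed.

(** The last condition records the link between x and z, which turns x into an
expectation as well. *)
Definition node_law (i : V) (p : node_space R e b i) : Prop :=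
  exists (I : finType) (w : I -> R) (c : I -> config e),
    [/\ forall k, 0 <= w k, \sum_k w k = 1,
        forall k, w k != 0 -> feasible_at b i (c k),
        forall (f : delta e i) g, \sum_k w k * g (c k (val f)) =
          state_mean (p.1.2 f)
            (fun l : 'I_(cap b (val f)).+1 => p.2 (zi l)) g
      & forall f : delta e i,
        \sum_(l < (cap b (val f)).+1) (l : nat)%:R * p.2 (zi l) = p.1.1 f].

(** A mixture of laws is a law, on the disjoint union of the index types. *)
Lemma node_law_convex i t (p q : node_space R e b i) : 0 <= t <= 1 ->
  node_law p -> node_law q -> node_law (t *: p + (1 - t) *: q).
Proof.
move=> t01 [I [w [c [w0 w1 cF cM cx]]]] [J [v [d [v0 v1 dF dM dx]]]].
exists (I + J)%type, (fun k => match k with inl k => t * w k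
                                         | inr l => (1 - t) * v l end).
exists (fun k => match k with inl k => c k | inr l => d l end).
split.
- by move=> [k|l]; apply: mulr_ge0 => //; lra.
- by rewrite big_sumType /= -!mulr_sumr w1 v1; ring.
- by move=> [k|l]; rewrite mulf_eq0 negb_or => /andP[_]; [apply: cF|apply: dF].
- move=> f g; rewrite big_sumType /=.
  under eq_bigr => k _ do rewrite -mulrA.
  under [X in _ + X]eq_bigr => k _ do rewrite -mulrA.
  rewrite -!mulr_sumr cM dM -state_mean_affine !ffunE; congr state_mean.
  by apply/funext => l; rewrite !ffunE.
- move=> f; rewrite !ffunE -cx -dx /GRing.scale /= !mulr_sumr -big_split /=.
  by apply: eq_bigr => l _; rewrite !ffunE /GRing.scale /=; ring.
Qed.

Lemma node_law_of_hull i (p : node_space R e b i) :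
  conv_hull (single_node_relaxation R e b i) p -> node_law p.
Proof.
apply: (conv_hull_min (C := @node_law i)) => [t q r|q qR].
  exact: node_law_convex.
have [c cF ->] := node_point_onto qR.
exists unit, (fun=> 1), (fun=> c); split=> //.
- by rewrite big_const card_unit /= addr0.
- move=> f g; rewrite big_const card_unit /= addr0 mul1r ffunE.
  rewrite (_ : (fun l => _) =
    fun l : 'I_(cap b (val f)).+1 => (l == (c (val f)).1 :> nat)%:R).
    by rewrite state_mean_point //; apply: (proj2 cF); exact: valP f.
  by apply/funext => l; rewrite ffunE.
- move=> f; rewrite ffunE; under eq_bigr => l _ do rewrite ffunE /=.
  by rewrite (@sum_indicator _ _ (fun l => l%:R)) // (cap_bound cF) ?(valP f).
Qed.

Definition edge_mean (y : {ffun edge e -> R}) (z : {ffun zindex e b -> R})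
    (f : edge e) : (nat * bool -> R) -> R :=
  state_mean (y f) (fun l : 'I_(cap b f).+1 =>
    z (Tagged (fun f : edge e => 'I_(cap b f).+1) l)).

Lemma node_law_restrict i x y (z : {ffun zindex e b -> R}) :
  node_law (restrict i x y z) ->
  has_law b [set i]%SET (edge_mean y z) /\
  forall f : edge e, i \in val f -> x f = edge_mean y z f (fun s => s.1%:R).
Proof.
move=> [I [w [c [w0 w1 cF cM cx]]]].
have restrict_mean (f : delta e i) g : state_mean ((restrict i x y z).1.2 f)
    (fun l : 'I_(cap b (val f)).+1 => (restrict i x y z).2 (zi l)) g =
    edge_mean y z (val f) g.
  by rewrite /edge_mean ffunE; congr state_mean; apply/funext => l; rewrite ffunE.
split.
  exists I, w, c; split=> //.
    by move=> k j wk; rewrite inE => /eqP ->; exact: cF.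
  move=> j f; rewrite inE => /eqP -> fi g.
  by have := cM (Sub f fi) g; rewrite restrict_mean SubK.
move=> f fi; pose h : delta e i := Sub f fi.
have <- : val h = f by rewrite SubK.
have := cx h; rewrite ffunE => <-; rewrite -restrict_mean /state_mean /=.
rewrite !mulr0 !add0r; apply: eq_bigr => l _.
by rewrite subr0 mulrC.
Qed.

(** * The projection lies in the convex hull of the transportation problem *)

Definition flow_point (c : config e) : xy_space R e :=
  ([ffun f => (c f).1%:R], [ffun f => (c f).2%:R]).

Lemma flow_point_in (c : config e) :
  (forall i, feasible_at b i c) -> fctp R e b (flow_point c).
Proof.
move=> cF; split=> [i|f|f].
- under eq_bigr => f _ do rewrite ffunE.
  by rewrite -natr_sum ler_nat; have [] := cF i.
- rewrite !ffunE ler0n /= -natrM ler_nat.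
  have [i [j [_ fE]]] := edgeP f; apply: (proj2 (cF i)).
  by rewrite fE !inE eqxx.
- by rewrite ffunE; case: (c f).2; [right|left].
Qed.

Lemma projection_in_hull (x y : {ffun edge e -> R})
    (z : {ffun zindex e b -> R}) : is_tree e ->
  (forall i, conv_hull (single_node_relaxation R e b i) (restrict i x y z)) ->
  conv_hull (fctp R e b) (x, y).
Proof.
move=> tree_e nodes.
have [I [w [c [w0 w1 cF cM]]]] : has_law b finset.setT (edge_mean y z).
  apply: has_law_tree => // i.
  by have [] := node_law_restrict (node_law_of_hull (nodes i)).
have mean f g : \sum_k w k * g (c k f) = edge_mean y z f g.
  have [i [j [_ fE]]] := edgeP f.
  by apply: (cM i); rewrite ?fE !inE ?eqxx.
have xE f : x f = \sum_k w k * (c k f).1%:R.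
  have [i [j [_ fE]]] := edgeP f; rewrite (mean f (fun s => s.1%:R)).
  have [_] := node_law_restrict (node_law_of_hull (nodes i)); apply.
  by rewrite fE !inE eqxx.
have yE f : y f = \sum_k w k * (c k f).2%:R.
  rewrite (mean f (fun s => s.2%:R)) /edge_mean /state_mean /= big1.
    by rewrite mulr0 mulr1 add0r addr0.
  by move=> l _; rewrite subrr mulr0.
have -> : (x, y) = \sum_k w k *: flow_point (c k).
  rewrite [RHS]surjective_pairing; congr (_, _); apply/ffunP => f.
    rewrite (big_morph fst (id1 := 0) (op1 := +%R)) // sum_ffunE xE.
    by apply: eq_bigr => k _; rewrite !ffunE.
  rewrite (big_morph snd (id1 := 0) (op1 := +%R)) // sum_ffunE yE.
  by apply: eq_bigr => k _; rewrite !ffunE.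
apply: conv_hull_sum => // k wk; apply: flow_point_in => i.
by apply: cF; rewrite ?inE.
Qed.

(** * Lifting transportation plans by rounding *)

Section Rounding.
Variables (x y : {ffun edge e -> R}).
Hypothesis xyS : fctp R e b (x, y).

Let m (f : edge e) := Num.truncn (x f).
Let u (f : edge e) := x f - (m f)%:R.

Let x_bounds f : (m f)%:R <= x f < (m f).+1%:R.
Proof. by have [_ xb _] := xyS; apply: truncn_itv; have /andP[] := xb f. Qed.

(** The law of a variable equal to n with probability 1 - v and to n + 1 with
probability v. *)
Let interpolate (n : nat) (v : R) (l : nat) : R :=
  (1 - v) * (l == n)%:R + v * (l == n.+1)%:R.

(** For integral x_f the value floor(x_f) + 1, which may exceed the capacity,
has weight 0. *)
Definition rounding_z : {ffun zindex e b -> R} :=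
  [ffun k : zindex e b => interpolate (m (tag k)) (u (tag k)) (tagged k)].

(** The floors being fixed, the lifted point is an affine function of the vector
v of fractional parts, and 0-1 vectors v give integral points. *)
Let lift i (v : {ffun edge e -> R^o}) : node_space R e b i :=
  ([ffun f => (m (val f))%:R + v (val f)], [ffun f => y (val f)],
   [ffun k : zindex_at e b i =>
      interpolate (m (val (tag k))) (v (val (tag k))) (tagged k)]).

Let lift_affine i t v v' :
  lift i (t *: v + (1 - t) *: v') = t *: lift i v + (1 - t) *: lift i v'.
Proof.
by congr (_, _, _); apply/ffunP => k;
  rewrite !ffunE /interpolate /GRing.scale /=; ring.
Qed.

(** The vector of fractional parts at i is a convex combination of 0-1 vectors
with at most b_i minus the sum of the floors ones, all on edges with fractional
x_f; there the next integer still obeys the integral bound a_f y_f. *)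
Lemma rounding_in_hull i :
  conv_hull (single_node_relaxation R e b i) (restrict i x y rounding_z).
Proof.
have [xb xay y01] := xyS.
pose v : {ffun edge e -> R^o} := [ffun f : edge e => if i \in val f then u f else 0].
pose D := [set f : edge e | (i \in val f) && (u f != 0)]%SET.
pose M := (\sum_(f : edge e | i \in val f) m f)%N.
have -> : restrict i x y rounding_z = lift i v.
  congr (_, _, _); apply/ffunP => k; rewrite !ffunE //=.
    by rewrite (valP k) /u addrC subrK.
  by rewrite (valP (tag k)).
have Mb : (M <= b i)%N.
  rewrite -(ler_nat R) natr_sum; apply: le_trans (xb i).
  by apply: ler_sum => f _; have /andP[] := x_bounds f.
have vD f : f \notin D -> v f = 0.
  by rewrite inE negb_and negbK ffunE; case: ifP => //= _ /eqP.
have v01 f : 0 <= v f <= 1.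
  rewrite ffunE /u; have := x_bounds f; rewrite -natr1; case: ifP => _; lra.
have vK : \sum_f v f <= (b i - M)%N%:R.
  have -> : \sum_f v f = \sum_(f : edge e | i \in val f) u f.
    by rewrite [RHS]big_mkcond; apply: eq_bigr => f _; rewrite ffunE.
  by rewrite natrB // natr_sum sumrB lerB.
apply: (conv_hull_affine (@lift_affine i) _ (box_sum_le_integral v01 vD vK)).
move=> _ [A [AK AD] <-]; apply: conv_hull_sub.
pose c : config e := fun f => ((m f + (f \in A))%N, y f == 1).
have yE f : y f = (y f == 1)%:R.
  by case: (y01 f) => ->; rewrite ?eqxx // eq_sym oner_eq0.
have -> : lift i [ffun f => (f \in A)%:R] = node_point i c.
  congr (_, _, _); apply/ffunP => k; rewrite !ffunE.
  - by rewrite natrD.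
  - exact: yE.
  - rewrite /interpolate /=; case: (_ \in A).
      by rewrite subrr mul0r add0r mul1r addn1.
    by rewrite subr0 mul0r addr0 mul1r addn0.
apply: node_point_in; split.
  rewrite big_split /= -/M -leq_subRL //; apply: leq_trans AK.
  rewrite -sum1_card [X in (X <= _)%N]big_mkcond [X in (_ <= X)%N]big_mkcond /=.
  by apply: leq_sum => f _; case: ifP => _; case: (f \in A).
move=> f fi /=; have /andP[_ xa] := xay f; rewrite yE -natrM in xa.
have /andP[mx _] := x_bounds f.
have [fA|_] := boolP (f \in A); last first.
  by rewrite addn0 -(ler_nat R); apply: le_trans xa.
rewrite addn1 -(ltr_nat R); apply: lt_le_trans xa.
rewrite lt_neqAle mx andbT -subr_eq0 -oppr_eq0 opprB -/(u f).
by have /(fintype.subsetP AD) := fA; rewrite inE => /andP[].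
Qed.

End Rounding.

End FixedChargeTransportation.

Theorem mainTheorem5 (R : realType) (V : finType) (e : rel V) (b : V -> nat)
    (tree_e : is_tree e) :
  [set p : {ffun edge e -> R} * {ffun edge e -> R} |
     exists z : {ffun zindex e b -> R},
       forall i : V,
         conv_hull (single_node_relaxation R e b i) (restrict i p.1 p.2 z)]
  = conv_hull (fctp R e b).
Proof.
apply/seteqP; split=> [[x y] [z nodes]|]; first exact: projection_in_hull nodes.
apply: (@conv_hull_min _ (xy_space R e)) => [t p q t01 [z1 hz1] [z2 hz2]|[x y] xyS].
  exists [ffun k => t * z1 k + (1 - t) * z2 k] => i.
  rewrite (_ : restrict _ _ _ _ =
    t *: restrict i p.1 p.2 z1 + (1 - t) *: restrict i q.1 q.2 z2).
    exact: conv_hull_convex.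
  by congr (_, _, _); apply/ffunP => k; rewrite !ffunE.
by exists (rounding_z b x) => i; exact: rounding_in_hull.
Qed.
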